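(* Let $A,B\in\mathcal M_n$ be accretive with $W(A),W(B)\subset S_\alpha$ for some $0\le\alpha<\pi/2$, let $\Phi:\mathcal M_n\to\mathcal M_r$ be a positive linear map with $\Phi(\mathcal I)$ positive definite (so that $\Phi(A),\Phi(B)$ are accretive), and let $f\in\mathfrak m$. Then $$\Re\,\Phi(A\sigma_fB)\le\sec^2(\alpha)\,\Re\big(\Phi(A)\,\sigma_f\,\Phi(B)\big).$$
   Context: A matrix $A$ is accretive if $\Re A=\frac{A+A^*}{2}$ is positive definite. $W(A)$ is the numerical range, $S_\alpha=\{z:\Re z>0,\ |\Im z|\le\tan(\alpha)\Re z\}$. $\le$ is the Löwner order. A linear map $\Phi$ is positive if it maps positive semidefinite matrices to positive semidefinite matrices. $\mathfrak m$ is the set of matrix monotone $f:(0,\infty)\to(0,\infty)$ with $f(1)=1$; each has a unique probability measure $\nu_f$ on $[0,1]$ with $f(x)=\int_0^1((1-t)+tx^{-1})^{-1}d\nu_f(t)$, $x>0$. For accretive $A,B$: $A!_tB=((1-t)A^{-1}+tB^{-1})^{-1}$ and $A\sigma_fB:=\int_0^1A!_tB\,d\nu_f(t)$. *)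

(* Defs.v *)
From HB Require Import structures.
From mathcomp Require Import all_boot all_order all_algebra.
From mathcomp Require Import all_classical all_reals all_analysis.
From mathcomp Require Import complex.
From mathcomp Require Import sesquilinear spectral.

Set Implicit Arguments.
Unset Strict Implicit.
Unset Printing Implicit Defensive.
Import Order.TTheory GRing.Theory Num.Theory.
Local Open Scope classical_set_scope.
Local Open Scope ring_scope.
Local Open Scope complex_scope.
Local Open Scope sesquilinear_scope.

Section Defs.
Variable R : realType.
Local Notation C := R[i].

(* Hermitian matrices *)
Definition hermitian_mx n (M : 'M[C]_n) : Prop := M ^t* = M.

(* positive semidefinite / positive definite matrices *)
Definition psd_mx n (M : 'M[C]_n) : Prop :=
  hermitian_mx M /\ forall x : 'cV[C]_n, 0 <= (x ^t* *m M *m x) 0 0.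
Definition pd_mx n (M : 'M[C]_n) : Prop :=
  hermitian_mx M /\ forall x : 'cV[C]_n, x != 0 -> 0 < (x ^t* *m M *m x) 0 0.

(* Loewner order: A <= B iff B - A is positive semidefinite *)
Definition loewner_le n (A B : 'M[C]_n) : Prop := psd_mx (B - A).

(* real part  Re A = (A + A^* )/2 *)
Definition mxRe n (A : 'M[C]_n) : 'M[C]_n := (2%:R)^-1 *: (A + A ^t*).

Definition accretive n (A : 'M[C]_n) : Prop := pd_mx (mxRe A).

(* numerical range W(A) = { x^* A x : x^* x = 1 } *)
Definition numrange n (A : 'M[C]_n) : set C :=
  [set z | exists x : 'cV[C]_n, (x ^t* *m x) 0 0 = 1 /\ z = (x ^t* *m A *m x) 0 0].

(* sector S_alpha *)
Definition sector (a : R) : set C :=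
  [set z | 0 < complex.Re z /\ `|complex.Im z| <= tan a * complex.Re z].

(* positive linear maps *)
Definition positive_map n r (Phi : 'M[C]_n -> 'M[C]_r) : Prop :=
  forall A, psd_mx A -> psd_mx (Phi A).

(* diagonal matrix with real entries d *)
Definition rdiag n (d : 'rV[R]_n) : 'M[C]_n := diag_mx (map_mx (real_complex R) d).

(* matrix monotone on (0,oo): functional calculus via unitary diagonalization
   f(U^* diag(d) U) = U^* diag(f d) U for unitary U and d > 0 *)
Definition matrix_monotone (f : R -> R) : Prop :=
  forall m (U V : 'M[C]_m) (d e : 'rV[R]_m),
    U \is unitarymx -> V \is unitarymx ->
    (forall i, 0 < d 0 i) -> (forall i, 0 < e 0 i) ->
    loewner_le (U ^t* *m rdiag d *m U) (V ^t* *m rdiag e *m V) ->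
    loewner_le (U ^t* *m rdiag (map_mx f d) *m U)
               (V ^t* *m rdiag (map_mx f e) *m V).

(* weighted harmonic mean A !_t B = ((1-t)A^{-1} + t B^{-1})^{-1} *)
Definition hmean n (t : R) (A B : 'M[C]_n) : 'M[C]_n :=
  invmx ((1 - t)%:C *: invmx A + t%:C *: invmx B).

(* entrywise integral over [0,1] of a matrix-valued function *)
Definition mx_integral n (nu : {measure set R -> \bar R}) (F : R -> 'M[C]_n)
  : 'M[C]_n :=
  \matrix_(i, j) (Rintegral nu `[0, 1]%classic (fun t => complex.Re (F t i j))
                  +i* Rintegral nu `[0, 1]%classic (fun t => complex.Im (F t i j))).

(* the operator mean A sigma_f B = int_0^1 A !_t B dnu_f(t) *)
Definition sigma_mean n (nu : {measure set R -> \bar R}) (A B : 'M[C]_n) : 'M[C]_n :=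
  mx_integral nu (fun t => hmean t A B).

End Defs.

(* Main.v *)
Require Import Defs.
From HB Require Import structures.
From mathcomp Require Import all_boot all_order all_algebra.
From mathcomp Require Import all_classical all_reals all_analysis.
From mathcomp Require Import complex.
From mathcomp Require Import sesquilinear spectral measurable_realfun ring lra.
Import Order.TTheory GRing.Theory Num.Theory.
Import numFieldNormedType.Exports.
Local Open Scope classical_set_scope.
Local Open Scope ring_scope.
Local Open Scope complex_scope.

(** Write [A(x, y)] for [Re (x^* A y)].  If [w = (A !_t B) x], [a = A^-1 w] and
    [b = B^-1 w], then [x = (1 - t) a + t b] and, for every other decomposition
    [x = (1 - t) u + t v], [Re (x^* w) = (1 - t) A(u, a) + t B(v, b)].  The sector
    condition amounts to [2 A(u, a) <= A(a, a) + sec^2 alpha A(u, u)], so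
    [Re (x^* w) <= sec^2 alpha ((1 - t) A(u, u) + t B(v, v))].  Diagonalizing
    [Re A] and [Re B] by one congruence [S] and choosing the optimal [u], [v] gives
    [Re (A !_t B) <= sec^2 alpha \sum_i q_i P_i], where [Re A = \sum_i P_i],
    [Re B = \sum_i e_i P_i], [q_i = e_i / ((1 - t) e_i + t)] and the [P_i] are
    positive semidefinite.  Applying [Phi] and the scalar harmonic mean inequality
    for each [Phi P_i], along the decomposition attached to
    [Phi A !_t Phi B], yields the claim for every [t]; it is then integrated. *)

Section SectorialMeans.
Set Implicit Arguments.
Unset Strict Implicit.
Unset Printing Implicit Defensive.
Local Open Scope sesquilinear_scope.
Variable R : realType.
Local Notation C := R[i].

(** * Adjoints, and the real part of the sesquilinear form of a matrix *)

Lemma conjCc (z : C) : Num.conj z = (complex.Re z) -i* (complex.Im z).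
Proof. by case: z. Qed.

Lemma adjmxD m n (A B : 'M[C]_(m, n)) : (A + B) ^t* = A ^t* + B ^t*.
Proof. by rewrite linearD map_mxD. Qed.

Lemma adjmxN m n (A : 'M[C]_(m, n)) : (- A) ^t* = - A ^t*.
Proof. by rewrite linearN map_mxN. Qed.

Lemma adjmxZ m n c (A : 'M[C]_(m, n)) : (c *: A) ^t* = Num.conj c *: A ^t*.
Proof. by rewrite linearZ map_mxZ. Qed.

Lemma adjmxM m n p (A : 'M[C]_(m, n)) (B : 'M[C]_(n, p)) :
  (A *m B) ^t* = B ^t* *m A ^t*.
Proof. by rewrite trmx_mul map_mxM. Qed.

Lemma conj_RtoC (c : R) : Num.conj c%:C = c%:C.
Proof. by rewrite conjCc /= oppr0. Qed.

Lemma cReD (z w : C) : complex.Re (z + w) = complex.Re z + complex.Re w.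
Proof. by case: z; case: w. Qed.
Lemma cReM (z w : C) : complex.Re (z * w) =
  complex.Re z * complex.Re w - complex.Im z * complex.Im w.
Proof. by case: z; case: w. Qed.
Lemma cImD (z w : C) : complex.Im (z + w) = complex.Im z + complex.Im w.
Proof. by case: z; case: w. Qed.
Lemma cImM (z w : C) : complex.Im (z * w) =
  complex.Re z * complex.Im w + complex.Im z * complex.Re w.
Proof. by case: z; case: w => a b c d /=. Qed.
Lemma cReZ (k : R) (w : C) : complex.Re (k%:C * w) = k * complex.Re w.
Proof. by rewrite cReM /= mul0r subr0. Qed.

(** Bilinear over the reals and real valued, so that all estimates take place in [R]. It need not be
    symmetric: its skew part comes from the skew-Hermitian part of [M]. *)
Definition rform n (M : 'M[C]_n) (x y : 'cV[C]_n) : R :=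
  complex.Re ((x ^t* *m M *m y) 0 0).

Lemma rformDl n (M : 'M[C]_n) x y z : rform M (x + y) z = rform M x z + rform M y z.
Proof. by rewrite /rform adjmxD !mulmxDl mxE cReD. Qed.
Lemma rformDr n (M : 'M[C]_n) x y z : rform M x (y + z) = rform M x y + rform M x z.
Proof. by rewrite /rform !mulmxDr mxE cReD. Qed.
Lemma rformDm n (M N : 'M[C]_n) x y : rform (M + N) x y = rform M x y + rform N x y.
Proof. by rewrite /rform mulmxDr mulmxDl mxE cReD. Qed.
Lemma rformZl n (M : 'M[C]_n) k x y : rform M (k%:C *: x) y = k * rform M x y.
Proof. by rewrite /rform adjmxZ conj_RtoC -!scalemxAl mxE cReZ. Qed.
Lemma rformZr n (M : 'M[C]_n) k x y : rform M x (k%:C *: y) = k * rform M x y.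
Proof. by rewrite /rform -scalemxAr mxE cReZ. Qed.
Lemma rformZm n (M : 'M[C]_n) k x y : rform (k%:C *: M) x y = k * rform M x y.
Proof. by rewrite /rform -scalemxAr -scalemxAl mxE cReZ. Qed.
Lemma rformNl n (M : 'M[C]_n) x y : rform M (- x) y = - rform M x y.
Proof. by have := rformZl M (-1) x y; rewrite rmorphN1 scaleN1r mulN1r. Qed.
Lemma rformNr n (M : 'M[C]_n) x y : rform M x (- y) = - rform M x y.
Proof. by have := rformZr M (-1) x y; rewrite rmorphN1 scaleN1r mulN1r. Qed.
Lemma rformNm n (M : 'M[C]_n) x y : rform (- M) x y = - rform M x y.
Proof. by have := rformZm M (-1) x y; rewrite rmorphN1 scaleN1r mulN1r. Qed.
Lemma rform0 n (M : 'M[C]_n) x : rform M x 0 = 0.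
Proof. by rewrite /rform mulmx0 mxE. Qed.
Lemma rform_sum n I (s : seq I) (M : I -> 'M[C]_n) x y :
  rform (\sum_(i <- s) M i) x y = \sum_(i <- s) rform (M i) x y.
Proof.
elim/big_ind2: _ => [|M1 a M2 b <- <-|//]; last by rewrite rformDm.
by rewrite /rform mulmx0 mul0mx mxE.
Qed.

Lemma form_adj n (M : 'M[C]_n) (x y : 'cV[C]_n) :
  (x ^t* *m M ^t* *m y) 0 0 = Num.conj ((y ^t* *m M *m x) 0 0).
Proof.
have -> : x ^t* *m M ^t* *m y = (y ^t* *m M *m x) ^t*.
  by rewrite !adjmxM trmxCK mulmxA.
by rewrite !mxE.
Qed.

Lemma rform_adj n (M : 'M[C]_n) x y : rform (M ^t*) x y = rform M y x.
Proof. by rewrite /rform form_adj conjCc. Qed.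

Lemma rform_cong n m (M : 'M[C]_n) (S : 'M[C]_(n, m)) x y :
  rform (S ^t* *m M *m S) x y = rform M (S *m x) (S *m y).
Proof. by rewrite /rform adjmxM !mulmxA. Qed.

Lemma rformM n (M N : 'M[C]_n) x y : rform (M *m N) x y = rform M x (N *m y).
Proof. by rewrite /rform !mulmxA. Qed.

(** * Hermitian, positive and accretive matrices in terms of [rform] *)

Lemma rform_mxRe n (M : 'M[C]_n) x : rform (mxRe M) x x = rform M x x.
Proof.
by rewrite /mxRe (_ : (2%:R : C)^-1 = (2^-1 : R)%:C) ?rformZm ?rformDm ?rform_adj;
  [field | rewrite fmorphV rmorph_nat].
Qed.

Lemma mxRe_herm n (M : 'M[C]_n) : hermitian_mx (mxRe M).
Proof.
rewrite /hermitian_mx /mxRe adjmxZ adjmxD trmxCK addrC.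
by rewrite fmorphV rmorph_nat.
Qed.

Lemma herm_form n (M : 'M[C]_n) x : hermitian_mx M ->
  (x ^t* *m M *m x) 0 0 = (rform M x x)%:C.
Proof.
move=> hM; have := form_adj M x x; rewrite hM /rform.
case: (_ 0 0) => a b /= [/eqP]; rewrite -addr_eq0 -mulr2n mulrn_eq0 /=.
by move/eqP->.
Qed.

Lemma psd_mxP n (M : 'M[C]_n) :
  psd_mx M <-> hermitian_mx M /\ forall x, 0 <= rform M x x.
Proof.
split=> -[hM h]; split=> // x; have := h x; rewrite (herm_form _ hM) ?lecR //.
Qed.

Lemma pd_mxP n (M : 'M[C]_n) :
  pd_mx M <-> hermitian_mx M /\ forall x, x != 0 -> 0 < rform M x x.
Proof.
split=> -[hM h]; split=> // x x0; have := h x x0; rewrite (herm_form _ hM) ?ltcR //.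
Qed.

Lemma accretiveP n (A : 'M[C]_n) :
  accretive A <-> forall x, x != 0 -> 0 < rform A x x.
Proof.
rewrite /accretive pd_mxP; split=> [[_ h] x /h|h]; first by rewrite rform_mxRe.
by split=> [|x /h]; [exact: mxRe_herm|rewrite rform_mxRe].
Qed.

Lemma accretive_ge0 n (A : 'M[C]_n) x : accretive A -> 0 <= rform A x x.
Proof.
move/accretiveP => h; have [->|/h/ltW//] := eqVneq x 0; by rewrite rform0.
Qed.

(** A kernel vector [v] would give [v^* A v = 0]. The transpose enters because row freeness speaks
    of row vectors. *)
Lemma accretive_unit n (A : 'M[C]_n) : accretive A -> A \in unitmx.
Proof.
move=> /accretiveP h; rewrite -unitmx_tr -row_free_unit; apply: inj_row_free => v vA.
apply/eqP; apply/negPn/negP => v0.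
have : 0 < rform A v^T v^T by apply: h; rewrite trmx_eq0.
by rewrite /rform -mulmxA -[A]trmxK -trmx_mul vA trmx0 mulmx0 mxE ltxx.
Qed.

(** With [x = A y], [Re (x^* A^-1 x) = Re (y^* A^* y) = Re (y^* A y)]. *)
Lemma accretive_invmx n (A : 'M[C]_n) : accretive A -> accretive (invmx A).
Proof.
move=> aA; have uA := accretive_unit aA; move/accretiveP: aA => h.
apply/accretiveP => x x0; set y := invmx A *m x.
have xE : x = A *m y by rewrite mulKVmx.
have y0 : y != 0 by apply: contraNneq x0 => y0; rewrite xE y0 mulmx0.
rewrite {1}xE.
have -> : rform (invmx A) (A *m y) x = rform (A ^t*) y y.
  by rewrite /rform adjmxM -!mulmxA.
by rewrite rform_adj h.
Qed.

Lemma accretive_conv n (A B : 'M[C]_n) (t : R) : accretive A -> accretive B ->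
  0 <= t <= 1 -> accretive ((1 - t)%:C *: A + t%:C *: B).
Proof.
move=> aA aB /andP[t0 t1]; apply/accretiveP => x x0.
move/accretiveP: aA => /(_ _ x0); move/accretiveP: aB => /(_ _ x0).
rewrite rformDm !rformZm; move: (rform A x x) (rform B x x) => p q; nra.
Qed.

(** * The harmonic mean bounded along a decomposition of the vector *)

Lemma hmean_decomp n (A B : 'M[C]_n) (t : R) (x : 'cV[C]_n) :
  accretive A -> accretive B ->
  0 <= t <= 1 -> exists a b,
  [/\ A *m a = hmean t A B *m x, B *m b = hmean t A B *m x &
      x = (1 - t)%:C *: a + t%:C *: b].
Proof.
move=> aA aB ht; have uA := accretive_unit aA; have uB := accretive_unit aB.
have uX := accretive_unit
  (accretive_conv (accretive_invmx aA) (accretive_invmx aB) ht).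
set w := hmean t A B *m x; exists (invmx A *m w), (invmx B *m w).
rewrite !mulKVmx //; split=> //.
by rewrite !scalemxAl -mulmxDl /w /hmean mulKVmx.
Qed.

(** For accretive [A], maximizing over [a] turns this into [(Re (A^-1))^-1 <= c Re A]; the form with
    free vectors avoids inverses. *)
Definition sectorial_form n (A : 'M[C]_n) (c : R) :=
  forall u a, 2 * rform A u a <= rform A a a + c * rform A u u.

(** Both sides are [Re (x^* w)] with [w = A a = B b]. The pair [u], [v] is independent of [a], [b],
    so one [w] serves several decompositions. *)
Lemma rform_hmean n (A B : 'M[C]_n) (t : R) (x a b u v : 'cV[C]_n) :
  A *m a = hmean t A B *m x -> B *m b = hmean t A B *m x ->
  x = (1 - t)%:C *: u + t%:C *: v ->
  rform (hmean t A B) x x = (1 - t) * rform A u a + t * rform B v b.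
Proof.
move=> ea eb ex; rewrite -[hmean t A B]mul1mx rformM {1}ex rformDl !rformZl.
by rewrite -{1}ea -eb -!rformM !mul1mx.
Qed.

Lemma hmean_le n (A B : 'M[C]_n) (c t : R) (x u v : 'cV[C]_n) :
  accretive A -> accretive B ->
  sectorial_form A c -> sectorial_form B c ->
  0 <= t <= 1 -> x = (1 - t)%:C *: u + t%:C *: v ->
  rform (hmean t A B) x x <= c * ((1 - t) * rform A u u + t * rform B v v).
Proof.
move=> aA aB sA sB ht ex; have [a [b [ea eb exab]]] := hmean_decomp x aA aB ht.
(* The identity is used for [u], [v] and for [a], [b] itself. With [N] the form at [x], the weighted
   sum of the two sector inequalities then reads [2 N <= N + c ((1 - t) A(u, u) + t B(v, v))]. *)
have e1 := rform_hmean ea eb ex; have e2 := rform_hmean ea eb exab.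
move: e1 e2 (sA u a) (sB v b) ht; move: (rform A u a) (rform B v b).
move: (rform A a a) (rform B b b) (rform A u u) (rform B v v) (rform _ x x).
move=> aa bb uu vv N ua vb e1 e2 hA hB /andP[t0 t1].
have {}hA : 0 <= (1 - t) * (aa + c * uu - 2 * ua) by rewrite mulr_ge0 ?subr_ge0.
have {}hB : 0 <= t * (bb + c * vv - 2 * vb) by rewrite mulr_ge0 ?subr_ge0.
lra.
Qed.

(** * From the numerical range to the inequality [sectorial_form] *)

Lemma rform1_gt0 n (x : 'cV[C]_n) : x != 0 -> 0 < rform 1%:M x x.
Proof.
move=> x0; rewrite /rform mulmx1 mxE.
have -> : complex.Re (\sum_j (x ^t*) 0 j * x j 0) =
    \sum_j (complex.Re (x j 0) ^+ 2 + complex.Im (x j 0) ^+ 2).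
  elim/big_ind2: _ => [//|a b c d <- <-|j _]; first by rewrite cReD.
  by rewrite !mxE conjCc; case: (x j 0) => a b /=; ring.
rewrite lt_def psumr_eq0; last by move=> j _; rewrite addr_ge0 ?sqr_ge0.
rewrite sumr_ge0 ?andbT; last by move=> j _; rewrite addr_ge0 ?sqr_ge0.
apply: contraNN x0 => /allP h; apply/eqP/colP => j; rewrite mxE.
have := h j (mem_index_enum _); rewrite /= paddr_eq0 ?sqr_ge0 // !sqrf_eq0.
by case: (x j 0) => a b /= /andP[/eqP-> /eqP->].
Qed.

(** Since [(i x)^* = - i x^*] and [Re (- i z) = Im z], imaginary parts too are expressed by
    [rform]. *)
Lemma rformiE n (A : 'M[C]_n) x y :
  rform A ('i%C *: x) y = complex.Im ((x ^t* *m A *m y) 0 0).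
Proof.
rewrite /rform adjmxZ -!scalemxAl mxE conjCc /=.
by case: (_ 0 0) => a b /=; ring.
Qed.

Lemma rformii n (A : 'M[C]_n) x y :
  rform A ('i%C *: x) ('i%C *: y) = rform A x y.
Proof.
rewrite rformiE -scalemxAr mxE /rform.
by case: (_ 0 0) => a b /=; ring.
Qed.

Lemma scaleii n (x : 'cV[C]_n) : 'i%C *: ('i%C *: x) = - x.
Proof. by rewrite scalerA -expr2 sqr_i scaleN1r. Qed.

Lemma sector_form n (A : 'M[C]_n) alpha x : numrange A `<=` sector alpha ->
  `|rform A ('i%C *: x) x| <= tan alpha * rform A x x.
Proof.
move=> hA; have [->|x0] := eqVneq x 0; first by rewrite !rform0 normr0 mulr0.
have s0 := rform1_gt0 x0; set s := rform _ _ _ in s0.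
(* The numerical range only sees unit vectors: [x] is scaled by [k = 1 / |x|], and the factor [k^2]
   cancels at the end. *)
pose k := (Num.sqrt s)^-1.
have k0 : 0 < k by rewrite invr_gt0 sqrtr_gt0.
have k2 : k * k * s = 1.
  by rewrite -invfM -expr2 sqr_sqrtr ?ltW // mulVf ?gt_eqF.
have kE (M : 'M[C]_n) : ((k%:C *: x) ^t* *m M *m (k%:C *: x)) 0 0 =
    (k * k)%:C * (x ^t* *m M *m x) 0 0.
  by rewrite adjmxZ conj_RtoC -scalemxAr -!scalemxAl !mxE mulrA -rmorphM.
have [] := hA (((k%:C *: x) ^t* *m A *m (k%:C *: x)) 0 0).
  exists (k%:C *: x); split=> //.
  rewrite -[_ ^t* in LHS]mulmx1 kE herm_form ?/hermitian_mx ?trmx1 ?map_mx1 //.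
  by rewrite -/s -rmorphM k2.
rewrite kE cReZ rformiE cImM /= mul0r addr0 normrM.
rewrite (gtr0_norm (mulr_gt0 k0 k0)) => _.
by rewrite mulrCA ler_pM2l ?mulr_gt0.
Qed.

Definition nsq (z : C) : R := complex.Re z ^+ 2 + complex.Im z ^+ 2.

Lemma nsq_ge0 z : 0 <= nsq z.
Proof. by rewrite addr_ge0 ?sqr_ge0. Qed.

Lemma nsqZ k z : nsq (k%:C * z) = k ^+ 2 * nsq z.
Proof. by case: z => a b; rewrite /nsq /=; ring. Qed.

Lemma rform_rdiag n (d : 'rV[R]_n) x :
  rform (rdiag d) x x = \sum_i d 0 i * nsq (x i 0).
Proof.
rewrite /rform -mulmxA /rdiag mul_diag_mx mxE.
elim/big_ind2: _ => [//|a b c e <- <-|j _]; first by rewrite cReD.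
by rewrite !mxE conjCc /nsq; case: (x j 0) => a b /=; ring.
Qed.

Lemma rdiag_herm n (d : 'rV[R]_n) : hermitian_mx (rdiag d).
Proof.
rewrite /hermitian_mx /rdiag tr_diag_mx map_diag_mx -map_mx_comp.
by congr diag_mx; apply/matrixP => i j; rewrite !mxE /= conj_RtoC.
Qed.

Opaque rform.

(* Polarizing [x |-> rform A ('i x) x] recovers the skew part of [rform A]. *)
Lemma skew_part_le n (A : 'M[C]_n) tau :
  (forall x, `|rform A ('i%C *: x) x| <= tau * rform A x x) ->
  forall u z, rform A u z - rform A z u <= tau * (rform A u u + rform A z z).
Proof.
(* The witness is [v = - i u]. *)
move=> h u z; have [v [iv vE vv]] : exists v, [/\ 'i%C *: v = u,
    rform A ('i%C *: z) v = - rform A z u & rform A v v = rform A u u].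
  exists (- ('i%C *: u)); rewrite scalerN scaleii opprK rformNr rformii.
  by rewrite rformNl rformNr opprK rformii.
have := h (v + z); have := h (v - z).
rewrite !scalerDr scalerN iv !(rformDl, rformDr, rformNl, rformNr) vE vv.
move: (rform A u u) (rform A z z) (rform A u z) (rform A u v) (rform A z u).
clear vE vv.
move: (rform A v z) (rform A z v) (rform A ('i%C *: z) z) => a b d e g k l m.
(* Subtracting the lower bound at [v - z] from the upper bound at [v + z] cancels the cross terms
   and leaves twice the claim. *)
rewrite !ler_norml => /andP[h1 _] /andP[_ h2]; lra.
Qed.

(** Substituting [a = u + z] and expanding, the claim becomes the inequality [key] on the skew
    part. *)
Lemma sectorial_form_tan n (A : 'M[C]_n) tau : accretive A -> 0 <= tau ->
  (forall x, `|rform A ('i%C *: x) x| <= tau * rform A x x) ->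
  sectorial_form A (1 + tau ^+ 2).
Proof.
move=> aA tau0 h u a; pose z := a - u.
have q0 x := accretive_ge0 x aA.
have key : rform A u z - rform A z u <= rform A z z + tau ^+ 2 * rform A u u.
  have [tau00|taun0] := eqVneq tau 0.
    apply: le_trans (skew_part_le h u z) _.
    by rewrite tau00 expr2 !mul0r addr0.
  have taup : 0 < tau by rewrite lt_def taun0.
  (* Scaling [u] by [tau] and then dividing by [tau] moves the whole constant onto [A(u, u)], as
     [tau^2]; hence the separate case [tau = 0]. *)
  have := skew_part_le h (tau%:C *: u) z.
  rewrite !(rformZl, rformZr) -mulrBr ler_pM2l // => /le_trans; apply.
  by rewrite le_eqVlt; apply/orP; left; apply/eqP; ring.
have := q0 z; move: key.
rewrite /z !(rformDl, rformDr, rformNl, rformNr).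
by move: (rform A a a) (rform A u u) (rform A a u) (rform A u a) => *; lra.
Qed.

Lemma sectorial_form_cos n (A : 'M[C]_n) alpha : accretive A ->
  0 <= alpha -> alpha < pi / 2 -> numrange A `<=` sector alpha ->
  sectorial_form A ((cos alpha) ^- 2).
Proof.
move=> aA a0 a1 hA.
have c0 : 0 < cos alpha.
  by apply: cos_gt0_pihalf; rewrite a1 andbT; have := @pi_gt0 R; lra.
rewrite cos2_tan2 ?gt_eqF //; apply: sectorial_form_tan => // [|x].
  rewrite divr_ge0 ?(ltW c0) // sin_ge0_pi // a0 /= (le_trans (ltW a1)) //.
  by have := @pi_gt0 R; lra.
exact: sector_form.
Qed.

(** * Diagonalization by congruence *)

Lemma cong_herm m n (M : 'M[C]_m) (S : 'M[C]_(m, n)) :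
  hermitian_mx M -> hermitian_mx (S ^t* *m M *m S).
Proof. by move=> hM; rewrite /hermitian_mx !adjmxM trmxCK hM mulmxA. Qed.

Definition cdiag n (S : 'M[C]_n) (d : 'rV[R]_n) := S ^t* *m rdiag d *m S.

(** This is [s^* s] for [s] the [i]-th row of [S]: the matrix [P_i] of the outline. *)
Definition cproj n (S : 'M[C]_n) (i : 'I_n) := cdiag S (delta_mx 0 i).

Lemma cdiag_herm n (S : 'M[C]_n) d : hermitian_mx (cdiag S d).
Proof. exact/cong_herm/rdiag_herm. Qed.

Lemma rform_cdiag n (S : 'M[C]_n) d x :
  rform (cdiag S d) x x = \sum_i d 0 i * nsq ((S *m x) i 0).
Proof. by rewrite rform_cong rform_rdiag. Qed.

Lemma cproj_psd n (S : 'M[C]_n) i : psd_mx (cproj S i).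
Proof.
apply/psd_mxP; split=> [|x]; first exact: cdiag_herm.
rewrite rform_cdiag sumr_ge0 // => j _; rewrite mulr_ge0 ?nsq_ge0 //.
by rewrite mxE; case: (_ && _).
Qed.

Lemma cdiag_sum n (S : 'M[C]_n) d : cdiag S d = \sum_i (d 0 i)%:C *: cproj S i.
Proof.
rewrite /cproj /cdiag.
under eq_bigr do rewrite scalemxAl scalemxAr.
rewrite -mulmx_suml -mulmx_sumr; congr (_ *m _ *m _).
apply/matrixP => j k; rewrite summxE /rdiag !mxE (bigD1 j) //= big1 => [|i ij].
  by rewrite !mxE !eqxx /= addr0; case: eqP => //= _;
    rewrite ?mulr1n ?mulr1 ?mulr0n ?mulr0.
by rewrite !mxE eqxx /= [j == i]eq_sym (negPf ij) rmorph0 mul0rn mulr0.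
Qed.

Lemma pd_spectral n (H : 'M[C]_n) : pd_mx H ->
  exists P (d : 'rV[R]_n), [/\ P ^t* *m P = 1%:M, P *m P ^t* = 1%:M,
    H = cdiag P d & forall i, 0 < d 0 i].
Proof.
move=> /pd_mxP[hH pH]; pose P := spectralmx H.
have hs : H \is hermsymmx by apply/is_hermitianmxP; rewrite expr0 scale1r hH.
have uP := spectral_unitarymx H.
have PP : P *m P ^t* = 1%:M by apply/unitarymxP.
have PP' : P ^t* *m P = 1%:M by apply: mulmx1C.
pose d : 'rV[R]_n := \row_i complex.Re (spectral_diag H 0 i).
have HE : H = cdiag P d.
  have dE : spectral_diag H = map_mx (real_complex R) d.
    apply/rowP => i; rewrite !mxE.
    have /mxOverP/(_ 0 i) := hermitian_spectral_diag_real hs.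
    by rewrite CrealE conjCc; case: (spectral_diag H 0 i) => a b /eqP[/= /eqP];
      rewrite -subr_eq0 -opprD oppr_eq0 -mulr2n mulrn_eq0 /= => /eqP->.
  have /hermitian_normalmx/orthomx_spectralP := hs.
  by rewrite invmx_unitary // dE.
exists P, d; split=> // i.
(* The [i]-th column of [P^*] is an eigenvector, and [x^* H x = d_i] there. *)
pose x := P ^t* *m delta_mx i (0 : 'I_1).
have Px : P *m x = delta_mx i 0 by rewrite mulmxA PP mul1mx.
have x0 : x != 0.
  apply/eqP => xz; have := Px; rewrite xz mulmx0 => /matrixP/(_ i 0).
  by rewrite !mxE !eqxx => /esym/eqP; rewrite oner_eq0.
have := pH x x0; rewrite HE rform_cdiag Px (bigD1 i) //= big1 => [|j ji].
  by rewrite addr0 !mxE !eqxx /= /nsq /= expr0n expr1n addr0 mulr1.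
by rewrite [delta_mx _ _ _ _]mxE (negPf ji) /= /nsq /= expr0n addr0 mulr0.
Qed.

Lemma rdiag1 n : rdiag (const_mx 1) = 1%:M :> 'M[C]_n.
Proof. by rewrite /rdiag map_const_mx diag_const_mx. Qed.

Lemma rdiagM n (a b : 'rV[R]_n) :
  rdiag a *m rdiag b = rdiag (\row_i (a 0 i * b 0 i)).
Proof.
rewrite /rdiag mulmx_diag; congr diag_mx; apply/rowP => i.
by rewrite !mxE rmorphM.
Qed.

(** From [H = P^* D P] with [P] unitary, [T = D^(1/2) P] and its inverse is [T' = P^* D^(-1/2)]. *)
Lemma pd_factor n (H : 'M[C]_n) : pd_mx H ->
  exists T T' : 'M[C]_n, [/\ T' *m T = 1%:M, T *m T' = 1%:M & H = T ^t* *m T].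
Proof.
move=> pH; have [P [d [PP' PP HE dp]]] := pd_spectral pH.
pose s : 'rV[R]_n := \row_i Num.sqrt (d 0 i).
pose s' : 'rV[R]_n := \row_i (Num.sqrt (d 0 i))^-1.
have ss' : rdiag s' *m rdiag s = 1%:M.
  rewrite rdiagM -rdiag1; congr rdiag; apply/rowP => i.
  by rewrite !mxE mulVf // gt_eqF // sqrtr_gt0.
have ss : rdiag s *m rdiag s = rdiag d.
  rewrite rdiagM; congr rdiag; apply/rowP => i.
  by rewrite !mxE -expr2 sqr_sqrtr // ltW.
have T'T : P ^t* *m rdiag s' *m (rdiag s *m P) = 1%:M.
  by rewrite mulmxA -[P ^t* *m _ *m _]mulmxA ss' mulmx1.
exists (rdiag s *m P), (P ^t* *m rdiag s'); split=> //; first exact: mulmx1C.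
by rewrite HE adjmxM rdiag_herm [RHS]mulmxA -[X in _ = X *m _]mulmxA ss.
Qed.

(** Factor [H = T^* T], diagonalize [T'^* K T'] by a unitary [Q], and take [S = Q T]: since
    [Q^* Q = 1], the factor [Q] does not disturb [H]. *)
Lemma pd_simultaneous n (H K : 'M[C]_n) : pd_mx H -> pd_mx K ->
  exists (S : 'M[C]_n) (e : 'rV[R]_n), [/\ S \in unitmx,
    H = cdiag S (const_mx 1), K = cdiag S e & forall i, 0 < e 0 i].
Proof.
move=> /pd_factor[T [T' [T'T TT' HT]]] /pd_mxP[hK pK].
have pK' : pd_mx (T' ^t* *m K *m T').
  apply/pd_mxP; split=> [|x x0]; first exact: cong_herm.
  rewrite rform_cong pK //; apply: contraNneq x0 => T'x.
  by rewrite -[x]mul1mx -TT' -mulmxA T'x mulmx0.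
have [Q [e [QQ' QQ KE ep]]] := pd_spectral pK'.
exists (Q *m T), e; split=> //.
- rewrite unitmx_mul; have [-> _] := mulmx1_unit QQ.
  by have [-> _] := mulmx1_unit TT'.
- by rewrite /cdiag rdiag1 mulmx1 adjmxM -mulmxA (mulmxA _ Q) QQ' mul1mx.
- have -> : cdiag (Q *m T) e = T ^t* *m cdiag Q e *m T.
    by rewrite /cdiag adjmxM !mulmxA.
  have -> : T ^t* *m cdiag Q e *m T = (T' *m T) ^t* *m K *m (T' *m T).
    by rewrite -KE adjmxM !mulmxA.
  by rewrite T'T trmx1 map_mx1 mul1mx mulmx1.
Qed.

(** * Harmonic means in simultaneously diagonalizing coordinates *)

Lemma convex_gt0 (e t : R) : 0 < e -> 0 <= t <= 1 -> 0 < (1 - t) * e + t.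
Proof. by move=> e0 /andP[t0 t1]; nra. Qed.

(* The minimizers [u], [v] of [(1 - t) |u|^2 + t e |v|^2] subject to
   [(1 - t) u + t v = x] are [u = e x / ((1 - t) e + t)], [v = u / e]. *)
Lemma hmean_le_cdiag n (A B S : 'M[C]_n) (e : 'rV[R]_n) c t x :
  accretive A -> accretive B -> sectorial_form A c -> sectorial_form B c ->
  0 <= t <= 1 -> S \in unitmx -> mxRe A = cdiag S (const_mx 1) ->
  mxRe B = cdiag S e -> (forall i, 0 < e 0 i) ->
  rform (hmean t A B) x x <=
    c * rform (cdiag S (\row_i (e 0 i / ((1 - t) * e 0 i + t)))) x x.
Proof.
move=> aA aB sA sB ht uS AE BE ep.
have den i := convex_gt0 (ep i) ht.
have [y yE] : exists y, S *m x = y by exists (S *m x).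
(* [w f] has coordinates [f_i y_i] after applying [S]; below, [w f] and [w g] are the minimizers [u]
   and [v]. *)
pose w (f : 'I_n -> R) := invmx S *m \col_i ((f i)%:C * y i 0).
pose f i := e 0 i / ((1 - t) * e 0 i + t).
pose g i := ((1 - t) * e 0 i + t)^-1.
have Sw h : S *m w h = \col_i ((h i)%:C * y i 0) by rewrite mulKVmx.
have xE : x = (1 - t)%:C *: w f + t%:C *: w g.
  apply: (can_inj (mulKmx uS)); rewrite yE mulmxDr -2!scalemxAr !Sw.
  apply/colP => i; rewrite !mxE !mulrA -mulrDl -!rmorphM -rmorphD.
  have -> : (1 - t) * f i + t * g i = 1 by rewrite /f /g; field; exact: lt0r_neq0.
  by rewrite rmorph1 mul1r.
apply: le_trans (hmean_le aA aB sA sB ht xE) _.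
(* Equality holds coordinate by coordinate, because [(1 - t) f^2 + t e g^2 = f]. *)
rewrite le_eqVlt; apply/orP; left; apply/eqP; congr (_ * _).
rewrite -!(rform_mxRe A, rform_mxRe B) AE BE !rform_cdiag !mulr_sumr -big_split /=.
apply: eq_bigr => i _; rewrite !Sw yE !mxE !nsqZ /f /g.
move: (nsq _) => N; field; exact: lt0r_neq0.
Qed.

(** Multiplied by [(1 - t) e + t], the right side minus the left side is
    [t (1 - t) Q(u - e v, u - e v)]. *)
Lemma harmonic_le n (Q : 'M[C]_n) (e t : R) (x u v : 'cV[C]_n) : psd_mx Q ->
  0 < e -> 0 <= t <= 1 -> x = (1 - t)%:C *: u + t%:C *: v ->
  e / ((1 - t) * e + t) * rform Q x x <=
  (1 - t) * rform Q u u + t * (e * rform Q v v).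
Proof.
move=> /psd_mxP[_ pQ] e0 ht ->; have den := convex_gt0 e0 ht.
case/andP: ht => t0 t1; rewrite mulrAC ler_pdivrMr // -subr_ge0.
have := pQ (u - e%:C *: v).
rewrite !(rformDl, rformDr, rformNl, rformNr, rformZl, rformZr).
move: (rform Q u u) (rform Q u v) (rform Q v u) (rform Q v v) => a b b' d h.
have s0 : 0 <= 1 - t by rewrite subr_ge0.
have := mulr_ge0 (mulr_ge0 t0 s0) h; by congr (0 <= _); ring.
Qed.

(* Positive linear maps *)
Opaque cdiag cproj.

(* Four-term polarization, [4 M = \sum_k i^k (M + i^k)^* (M + i^k)], writes every
   matrix as a combination of positive semidefinite ones. *)
Lemma positive_map_adj n r (Phi : {linear 'M[C]_n -> 'M[C]_r}) M :
  positive_map Phi -> Phi (M ^t*) = (Phi M) ^t*.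
Proof.
move=> pPhi; pose N (k : C) := (M + k%:M) ^t* *m (M + k%:M).
(* [N k] is positive semidefinite, so its image is as well, and in particular is Hermitian. *)
have hN k : (Phi (N k)) ^t* = Phi (N k).
  apply: (pPhi _ _).1; apply/psd_mxP.
  have -> : N k = (M + k%:M) ^t* *m 1%:M *m (M + k%:M) by rewrite mulmx1.
  have h1 : hermitian_mx (1%:M : 'M[C]_n) by rewrite /hermitian_mx trmx1 map_mx1.
  split=> [|x]; first exact: cong_herm.
  rewrite rform_cong; have [->|x0] := eqVneq ((M + k%:M) *m x) 0.
    by rewrite rform0.
  exact/ltW/rform1_gt0.
have NE k : N k = M ^t* *m M + k *: M ^t* + Num.conj k *: M + (Num.conj k * k)%:M.
  rewrite /N adjmxD tr_scalar_mx map_scalar_mx /= mulmxDl !mulmxDr.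
  by rewrite mul_mx_scalar mul_scalar_mx -scalar_mxM addrA.
have c4 : (4^-1 : R)%:C = 4^-1 :> C by rewrite fmorphV rmorph_nat.
have cE : (Num.conj (1 : C) = 1) * (Num.conj (-1 : C) = -1) *
    (Num.conj ('i%C : C) = - 'i%C) * (Num.conj (- 'i%C : C) = 'i%C).
  by rewrite !conjCc; do !split; apply/eqP; rewrite eq_complex /= ?oppr0 ?opprK !eqxx.
have i2 : ('i%C : C) ^+ 2 = -1 by exact: sqr_i.
have ME : M = 4^-1%:C *: (N 1 + 'i%C *: N 'i%C - N (-1) - 'i%C *: N (- 'i%C)).
  apply/matrixP => i j; rewrite !NE !cE c4; move: (M ^t*) (M ^t* *m M) => Q P.
  rewrite !mxE; move: (P i j) (Q i j) (M i j) => a b d.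
  by case: (i == j); rewrite ?mulr1n ?mulr0n; field: i2.
(* The same combination with conjugated coefficients, so that the adjoint of [E2] is [E1]. *)
have MtE : M ^t* = 4^-1%:C *: (N 1 - 'i%C *: N 'i%C - N (-1) + 'i%C *: N (- 'i%C)).
  apply/matrixP => i j; rewrite !NE !cE c4; move: (M ^t*) (M ^t* *m M) => Q P.
  rewrite !mxE; move: (P i j) (Q i j) (M i j) => a b d.
  by case: (i == j); rewrite ?mulr1n ?mulr0n; field: i2.
clearbody N.
have E1 : Phi (M ^t*) = 4^-1%:C *: (Phi (N 1) - 'i%C *: Phi (N 'i%C)
    - Phi (N (-1)) + 'i%C *: Phi (N (- 'i%C))).
  by rewrite MtE linearZ /= (linearD Phi) !(linearB Phi) !linearZ.
have E2 : Phi M = 4^-1%:C *: (Phi (N 1) + 'i%C *: Phi (N 'i%C)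
    - Phi (N (-1)) - 'i%C *: Phi (N (- 'i%C))).
  by rewrite ME linearZ /= !(linearB Phi) (linearD Phi) !linearZ.
rewrite E1 E2.
rewrite !(adjmxZ, adjmxD, adjmxN) conj_RtoC !hN.
by rewrite !cE !scaleNr opprK.
Qed.

Lemma positive_map_mxRe n r (Phi : {linear 'M[C]_n -> 'M[C]_r}) M :
  positive_map Phi -> Phi (mxRe M) = mxRe (Phi M).
Proof. by move=> pPhi; rewrite /mxRe linearZ linearD /= positive_map_adj. Qed.

Opaque mxRe hmean.

Lemma rform_map_mxRe n r (Phi : {linear 'M[C]_n -> 'M[C]_r}) M x :
  positive_map Phi -> rform (Phi (mxRe M)) x x = rform (Phi M) x x.
Proof. by move=> pPhi; rewrite (positive_map_mxRe M pPhi) rform_mxRe. Qed.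

Lemma rform_map_cdiag n r (Phi : {linear 'M[C]_n -> 'M[C]_r}) S d x :
  rform (Phi (cdiag S d)) x x = \sum_i d 0 i * rform (Phi (cproj S i)) x x.
Proof.
rewrite cdiag_sum linear_sum rform_sum; apply: eq_bigr => i _.
by rewrite linearZ rformZm.
Qed.

Lemma hermB n (M N : 'M[C]_n) (c : R) :
  hermitian_mx M -> hermitian_mx N -> hermitian_mx (c%:C *: M - N).
Proof.
move=> hM hN; rewrite /hermitian_mx adjmxD adjmxN adjmxZ.
by rewrite conj_RtoC hM hN.
Qed.

Lemma pd1 n : pd_mx (1%:M : 'M[C]_n).
Proof.
apply/pd_mxP; split=> [|x]; last exact: rform1_gt0.
by rewrite /hermitian_mx trmx1 map_mx1.
Qed.

(** One congruence gives [Re A = \sum_i P_i] and [1 = \sum_i e_i P_i]. If the form of [Phi (Re A)]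
    vanished at [x], so would that of every [Phi P_i], hence that of [Phi 1]. *)
Lemma positive_map_accretive n r (Phi : {linear 'M[C]_n -> 'M[C]_r}) A :
  positive_map Phi -> pd_mx (Phi 1%:M) -> accretive A -> accretive (Phi A).
Proof.
move=> pPhi /pd_mxP[_ pPhi1] aA; apply/accretiveP => x /pPhi1.
have [S [e [_ AE IE _]]] := pd_simultaneous aA (pd1 n).
have w0 i : 0 <= rform (Phi (cproj S i)) x x.
  by have /pPhi/psd_mxP[_] := cproj_psd S i; apply.
rewrite IE rform_map_cdiag.
rewrite -(rform_map_mxRe A x pPhi).
rewrite AE rform_map_cdiag.
under [X in _ -> _ < X]eq_bigr do rewrite mxE mul1r.
move=> h; rewrite lt_def sumr_ge0 // andbT; apply: contraTneq h => /eqP.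
rewrite psumr_eq0 // => /allP h; rewrite big1 ?ltxx // => i _.
by have /eqP-> := h i (mem_index_enum i); rewrite mulr0.
Qed.

Lemma hmean_map_le n r (Phi : {linear 'M[C]_n -> 'M[C]_r}) (A B : 'M[C]_n) c t x :
  positive_map Phi -> pd_mx (Phi 1%:M) -> 0 <= c ->
  accretive A -> accretive B -> sectorial_form A c -> sectorial_form B c ->
  0 <= t <= 1 ->
  rform (Phi (hmean t A B)) x x <= c * rform (hmean t (Phi A) (Phi B)) x x.
Proof.
move=> pPhi pPhi1 c0 aA aB sA sB ht.
have [S [e [uS AE BE ep]]] := pd_simultaneous aA aB.
pose q := \row_i (e 0 i / ((1 - t) * e 0 i + t)).
(* A positive map transports only semidefiniteness, so the bound on forms is first recorded as a
   semidefinite difference. *)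
have psdD : psd_mx (c%:C *: cdiag S q - mxRe (hmean t A B)).
  apply/psd_mxP; split=> [|y].
    exact/hermB/mxRe_herm/cdiag_herm.
  rewrite rformDm rformNm rformZm rform_mxRe subr_ge0.
  exact: hmean_le_cdiag.
have /pPhi/psd_mxP[_ /(_ x)] := psdD.
rewrite linearD linearN linearZ /= rformDm rformNm rformZm subr_ge0.
rewrite (rform_map_mxRe _ x pPhi) => /le_trans; apply.
rewrite ler_wpM2l //.
have aPA := positive_map_accretive pPhi pPhi1 aA.
have aPB := positive_map_accretive pPhi pPhi1 aB.
(* Along this decomposition the form of [Phi A !_t Phi B] splits into a sum over the [Phi P_i],
   compared term by term by [harmonic_le]. *)
have [a [b [ea eb exab]]] := hmean_decomp x aPA aPB ht.
have EA : rform (Phi A) a a = \sum_i rform (Phi (cproj S i)) a a.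
  rewrite -(rform_map_mxRe A a pPhi) AE (rform_map_cdiag Phi S).
  by apply: eq_bigr => i _; rewrite mxE mul1r.
have EB : rform (Phi B) b b = \sum_i e 0 i * rform (Phi (cproj S i)) b b.
  by rewrite -(rform_map_mxRe B b pPhi) BE (rform_map_cdiag Phi S).
rewrite (rform_hmean ea eb exab) EA EB (rform_map_cdiag Phi S).
rewrite !mulr_sumr -big_split /=; apply: ler_sum => i _; rewrite mxE.
exact/harmonic_le/exab/ht/ep/pPhi/cproj_psd.
Qed.

Transparent rform hmean mxRe cdiag cproj.

(** * Continuity of complex-valued functions of a real variable *)

Local Notation I01 := (`[0, 1]%classic : set R).

(** Real and imaginary parts are kept apart to match [mx_integral]. *)
Definition ccont (g : R -> C) (t : R) :=
  {for t, continuous ((fun s => complex.Re (g s)) : R -> R)} /\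
  {for t, continuous ((fun s => complex.Im (g s)) : R -> R)}.

Lemma cont_ext (f h : R -> R) (t : R) :
  f =1 h -> {for t, continuous h} -> {for t, continuous f}.
Proof. by move=> /funext ->. Qed.

Lemma ccont_ext (g h : R -> C) t : g =1 h -> ccont h t -> ccont g t.
Proof. by move=> /funext ->. Qed.

Lemma ccont_cst c t : ccont (fun=> c) t.
Proof. by split; exact: cst_continuous. Qed.

Lemma ccont_RtoC (g : R -> R) t : {for t, continuous g} ->
  ccont (fun s => (g s)%:C) t.
Proof. by split => //; exact: cst_continuous. Qed.

Lemma ccontD g h t : ccont g t -> ccont h t -> ccont (fun s => g s + h s) t.
Proof.
move=> [g1 g2] [h1 h2]; split.
  by apply: (cont_ext (fun s => cReD _ _)); exact: continuousD.
by apply: (cont_ext (fun s => cImD _ _)); exact: continuousD.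
Qed.

Lemma ccontM g h t : ccont g t -> ccont h t -> ccont (fun s => g s * h s) t.
Proof.
move=> [g1 g2] [h1 h2]; split.
  by apply: (cont_ext (fun s => cReM _ _)); apply: continuousB; exact: continuousM.
by apply: (cont_ext (fun s => cImM _ _)); apply: continuousD; exact: continuousM.
Qed.

Lemma ccont_sum I (s : seq I) (P : pred I) (g : I -> R -> C) t :
  (forall i, ccont (g i) t) -> ccont (fun x => \sum_(i <- s | P i) g i x) t.
Proof.
move=> cg; elim: s => [|i s IH].
  by apply: (@ccont_ext _ (fun=> 0)); [move=> x; rewrite big_nil|exact: ccont_cst].
(* A term excluded by [P] becomes the constant [0], which is continuous too. *)
apply: (@ccont_ext _ (fun x => (if P i then g i x else 0) +
    \sum_(i <- s | P i) g i x)).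
  by move=> x; rewrite big_cons; case: (P i); rewrite ?add0r.
by apply: ccontD => //; case: (P i) => //; exact: ccont_cst.
Qed.

Lemma ccont_prod I (s : seq I) (P : pred I) (g : I -> R -> C) t :
  (forall i, ccont (g i) t) -> ccont (fun x => \prod_(i <- s | P i) g i x) t.
Proof.
move=> cg; elim: s => [|i s IH].
  by apply: (@ccont_ext _ (fun=> 1)); [move=> x; rewrite big_nil|exact: ccont_cst].
apply: (@ccont_ext _ (fun x => (if P i then g i x else 1) *
    \prod_(i <- s | P i) g i x)).
  by move=> x; rewrite big_cons; case: (P i); rewrite ?mul1r.
by apply: ccontM => //; case: (P i) => //; exact: ccont_cst.
Qed.

Lemma ccontV g t : g t != 0 -> ccont g t -> ccont (fun s => (g s)^-1) t.
Proof.
move=> gt0 [g1 g2].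
have ReV (z : C) : complex.Re z^-1 =
    complex.Re z * (complex.Re z ^+ 2 + complex.Im z ^+ 2)^-1 by case: z.
have ImV (z : C) : complex.Im z^-1 =
    - (complex.Im z * (complex.Re z ^+ 2 + complex.Im z ^+ 2)^-1) by case: z.
have cV : {for t, continuous
    ((fun s => (complex.Re (g s) ^+ 2 + complex.Im (g s) ^+ 2)^-1) : R -> R)}.
  apply: continuousV.
    rewrite paddr_eq0 ?sqr_ge0 // !sqrf_eq0.
    by move: gt0; rewrite eq_complex.
  by apply: continuousD; apply: continuousM.
split.
  by apply: (cont_ext (fun s => ReV _)); exact: continuousM.
by apply: (cont_ext (fun s => ImV _)); apply: continuousN; exact: continuousM.
Qed.

(** By the Leibniz formula, a determinant is a polynomial in the entries. *)
Lemma ccont_det n (X : R -> 'M[C]_n) t :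
  (forall i j, ccont (fun s => X s i j) t) -> ccont (fun s => \det (X s)) t.
Proof.
move=> cX; apply: ccont_sum => p; apply: ccontM; first exact: ccont_cst.
exact: ccont_prod.
Qed.

Lemma ccont_adj n (X : R -> 'M[C]_n) t i j :
  (forall i j, ccont (fun s => X s i j) t) -> ccont (fun s => (\adj (X s)) i j) t.
Proof.
move=> cX; apply: (@ccont_ext _ (fun s => cofactor (X s) j i)).
  by move=> s; rewrite mxE.
rewrite /cofactor; apply: ccontM; first exact: ccont_cst.
apply: ccont_det => k l; apply: (@ccont_ext _ (fun s => X s (lift j k) (lift i l))).
  by move=> s; rewrite !mxE.
exact: cX.
Qed.

(** * Integrating the harmonic means and moving linear maps through the integral *)

Section Integral.
Variable nu : probability R R.

Definition cintegrable (g : R -> C) :=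
  nu.-integrable I01 (EFin \o (fun s => complex.Re (g s))) /\
  nu.-integrable I01 (EFin \o (fun s => complex.Im (g s))).

Definition cint (g : R -> C) : C :=
  (Rintegral nu I01 (fun t => complex.Re (g t)) +i*
   Rintegral nu I01 (fun t => complex.Im (g t))).

(** Continuity on the compact interval gives measurability and boundedness, and the measure is
    finite. *)
Lemma integrable_cont (g : R -> R) :
  (forall t, 0 <= t <= 1 -> {for t, continuous g}) ->
  nu.-integrable I01 (EFin \o g).
Proof.
move=> cg; have cw : {within I01, continuous g}.
  apply: continuous_in_subspaceT => t; rewrite inE /= in_itv /=; exact: cg.
apply: measurable_bounded_integrable.
- exact: measurable_itv.
- exact: le_lt_trans (probability_le1 _ _) (ltry _).
- exact: subspace_continuous_measurable_fun.
- have /compact_bounded[M [_ mrt]] := continuous_compact cw (@segment_compact _ _ _).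
  by exists M; split; rewrite ?num_real // => ? ? ? ?; exact: mrt.
Qed.

Lemma cintegrable_ccont (g h : R -> C) :
  (forall t, 0 <= t <= 1 -> g t = h t) ->
  (forall t, 0 <= t <= 1 -> ccont h t) -> cintegrable g.
Proof.
move=> gh ch; split.
  apply: (@eq_integrable _ _ _ nu _ (measurable_itv _)
    (EFin \o (fun s => complex.Re (h s)))).
    by move=> t; rewrite inE /= in_itv /= => ht; rewrite gh.
  by apply: integrable_cont => t /ch[].
apply: (@eq_integrable _ _ _ nu _ (measurable_itv _)
    (EFin \o (fun s => complex.Im (h s)))).
  by move=> t; rewrite inE /= in_itv /= => ht; rewrite gh.
by apply: integrable_cont => t /ch[].
Qed.

(** Integrability and value are proved together, as additivity of the integral needs the
    integrability of the tail of the sum. *)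
Lemma cint_sum I (s : seq I) (c : I -> C) (g : I -> R -> C) :
  (forall i, cintegrable (g i)) ->
  nu.-integrable I01 (EFin \o (fun t => complex.Re (\sum_(i <- s) g i t * c i))) /\
  Rintegral nu I01 (fun t => complex.Re (\sum_(i <- s) g i t * c i)) =
    complex.Re (\sum_(i <- s) cint (g i) * c i).
Proof.
move=> ig; elim: s => [|i s [IH1 IH2]].
  have -> : (fun t => complex.Re (\sum_(i <- [::]) g i t * c i)) = cst 0.
    by apply/funext => t; rewrite big_nil.
  by rewrite big_nil Rintegral_cst //= mul0r; split; first exact: integrable0.
have [r1 r2] := ig i.
have mI : measurable (I01 : set R) by exact: measurable_itv.
have Zr (h : R -> R) k : nu.-integrable I01 (EFin \o h) ->
    nu.-integrable I01 (EFin \o (fun t => h t * k)).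
  by move=> ih; exact: (@integrableZr _ _ _ nu _ mI k (EFin \o h) ih).
have e1 : nu.-integrable I01 (EFin \o (fun t => complex.Re (g i t * c i))).
  have -> : (fun t => complex.Re (g i t * c i)) =
      (fun t => complex.Re (g i t) * complex.Re (c i) -
                complex.Im (g i t) * complex.Im (c i)).
    by apply/funext => t; exact: cReM.
  exact: (@integrableB _ _ _ nu _ mI
    (EFin \o (fun t => complex.Re (g i t) * complex.Re (c i)))
    (EFin \o (fun t => complex.Im (g i t) * complex.Im (c i)))
    (Zr _ _ r1) (Zr _ _ r2)).
have e2 : Rintegral nu I01 (fun t => complex.Re (g i t * c i)) =
    complex.Re (cint (g i) * c i).
  under eq_Rintegral do rewrite cReM.
  rewrite RintegralB //; [|exact: Zr|exact: Zr].
  by rewrite RintegralZr // RintegralZr // cReM.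
have -> : (fun t => complex.Re (\sum_(j <- i :: s) g j t * c j)) =
    (fun t => complex.Re (g i t * c i) + complex.Re (\sum_(j <- s) g j t * c j)).
  by apply/funext => t; rewrite big_cons cReD.
split.
  exact: (@integrableD _ _ _ nu _ mI
    (EFin \o (fun t => complex.Re (g i t * c i)))
    (EFin \o (fun t => complex.Re (\sum_(i <- s) g i t * c i)))).
by rewrite big_cons cReD -e2 -IH2 RintegralD.
Qed.

(** By Cramer's rule the entries are adjugate entries over the determinant, which is continuous and
    nonzero on [[0, 1]]. *)
Lemma cintegrable_hmean n (A B : 'M[C]_n) i j : accretive A -> accretive B ->
  cintegrable (fun t => hmean t A B i j).
Proof.
move=> aA aB; pose X t := (1 - t)%:C *: invmx A + t%:C *: invmx B.
have uX t : 0 <= t <= 1 -> X t \in unitmx.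
  move=> ht; have := accretive_conv (accretive_invmx aA) (accretive_invmx aB) ht.
  exact: accretive_unit.
have cX t k l : ccont (fun s => X s k l) t.
  apply: (@ccont_ext _ (fun s => (1 - s)%:C * invmx A k l + s%:C * invmx B k l)).
    by move=> s; rewrite !mxE.
  apply: ccontD; apply: ccontM; try exact: ccont_cst; apply: ccont_RtoC.
    by apply: continuousB; [exact: cst_continuous|exact: cvg_id].
  exact: cvg_id.
apply: (@cintegrable_ccont _ (fun t => (\det (X t))^-1 * (\adj (X t)) i j)) => t ht.
  by rewrite /hmean -/(X t) /invmx uX // mxE.
apply: ccontM; last exact: ccont_adj.
by apply: ccontV; [rewrite -unitfE -unitmxE uX|exact: ccont_det].
Qed.

(** The map [M |-> Re (x^* Psi(M) x)] equals [Re (\sum_p M_p c_p)], with [c_p] its complex values on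
    matrix units before taking real parts; such sums commute with the entrywise integral. *)
Lemma rform_mx_integral n r (Psi : {linear 'M[C]_n -> 'M[C]_r})
    (F : R -> 'M[C]_n) x :
  (forall i j, cintegrable (fun t => F t i j)) ->
  nu.-integrable I01 (EFin \o (fun t => rform (Psi (F t)) x x)) /\
  Rintegral nu I01 (fun t => rform (Psi (F t)) x x) =
    rform (Psi (mx_integral nu F)) x x.
Proof.
move=> iF.
pose c (p : 'I_n * 'I_n) := (x ^t* *m Psi (delta_mx p.1 p.2) *m x) 0 0.
have E (M : 'M[C]_n) : rform (Psi M) x x =
    complex.Re (\sum_(p : 'I_n * 'I_n) M p.1 p.2 * c p).
  rewrite {1}(matrix_sum_delta M) pair_big linear_sum /rform mulmx_sumr mulmx_suml.
  rewrite summxE; congr complex.Re; apply: eq_bigr => p _.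
  by rewrite linearZ /= -scalemxAr -scalemxAl mxE.
have [] := cint_sum (index_enum _) c (fun p => iF p.1 p.2).
have -> : (fun t => rform (Psi (F t)) x x) =
    (fun t => complex.Re (\sum_(p : 'I_n * 'I_n) F t p.1 p.2 * c p)).
  by apply/funext => t; rewrite E.
move=> h1 h2; split=> //; rewrite h2 E; congr complex.Re.
by apply: eq_bigr => p _; rewrite mxE.
Qed.

End Integral.
End SectorialMeans.

(** * Integration of the pointwise inequality *)

Theorem mainTheorem12 (R : realType) (n r : nat) (A B : 'M[R[i]]_n) (alpha : R)
  (Phi : {linear 'M[R[i]]_n -> 'M[R[i]]_r})
  (f : R -> R) (nu : probability R R) :
  accretive A -> accretive B ->
  0 <= alpha -> alpha < pi / 2 ->
  numrange A `<=` sector alpha -> numrange B `<=` sector alpha ->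
  positive_map Phi -> pd_mx (Phi 1%:M) ->
  (forall x, 0 < x -> 0 < f x) -> matrix_monotone f -> f 1 = 1 ->
  nu `[0, 1]%classic = 1%E ->
  (forall x, 0 < x -> f x = Rintegral nu `[0, 1]%classic (fun t => ((1 - t) + t / x)^-1)) ->
  loewner_le (mxRe (Phi (sigma_mean nu A B)))
             (((cos alpha) ^-2)%:C *: mxRe (sigma_mean nu (Phi A) (Phi B))).
Proof.
move=> aA aB a0 a1 nA nB pPhi pPhi1 _ _ _ _ _.
have sA := sectorial_form_cos aA a0 a1 nA.
have sB := sectorial_form_cos aB a0 a1 nB.
have aPA := positive_map_accretive pPhi pPhi1 aA.
have aPB := positive_map_accretive pPhi pPhi1 aB.
have c0 : 0 <= cos alpha ^- 2 by rewrite invr_ge0 sqr_ge0.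
apply/psd_mxP; split=> [|x]; first by apply: hermB; exact: mxRe_herm.
rewrite rformDm rformNm rformZm !rform_mxRe subr_ge0.
have [i1 e1] := @rform_mx_integral _ nu _ _ Phi _ x
  (fun i j => cintegrable_hmean nu i j aA aB).
(* On the right [Phi] sits inside the mean, so the linear map taken through the integral is the
   identity. *)
have [i2 e2] := @rform_mx_integral _ nu _ _ idfun _ x
  (fun i j => cintegrable_hmean nu i j aPA aPB).
rewrite /sigma_mean -e1 -[rform (mx_integral nu _) x x]e2.
have mI : measurable (`[0, 1]%classic : set R) by exact: measurable_itv.
rewrite -RintegralZl //; apply: le_Rintegral => //.
  exact: (@integrableZl _ _ _ nu _ mI _ _ i2).
by move=> t; rewrite /= in_itv /= => ht; exact: hmean_map_le.
Qed.
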